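(* For all integers $n,m\ge 1$, the grid $G=P_n\Box P_m$ satisfies $\mathrm{pind}(A_G)=1$, and hence $G$ is $(2,2)$-choosable.
   Context: Graphs are finite and simple. The grid $P_n\Box P_m$ is the Cartesian product of two paths: its vertex set is $\{(i,j):1\le i\le n,\ 1\le j\le m\}$ and its edge set is $\{(i,j)(i',j'): i=i',\,j'=j+1\ \text{or}\ i'=i+1,\,j'=j\}$. The matrix $A_G$: fix an orientation of $G$. $A_G$ is the real matrix with rows indexed by $E(G)$ and columns indexed by $V(G)\cup E(G)$, where for an edge $e$ oriented from $a$ to $b$: $A_G[e,z]=1$ if $z=b$ or $z\neq e$ is an edge incident to $b$; $A_G[e,z]=-1$ if $z=a$ or $z\ne e$ is an edge incident to $a$; and $A_G[e,z]=0$ otherwise. (Changing the orientation only multiplies rows by $-1$, so the notion below does not depend on it.) The permanent of an $m\times m$ matrix $A$ is $\mathrm{per}(A)=\sum_{\sigma\in S_m}\prod_{i=1}^m A[i,\sigma(i)]$ (the empty matrix has permanent $1$). The permanent index $\mathrm{pind}(A)$ of a matrix $A$ is the minimum positive integer $k$ such that there is a square matrix $A'$ (with the same rows as $A$) with $\mathrm{per}(A')\ne0$, each column of $A'$ is a column of $A$, and each column of $A$ (identified by its column index) occurs in $A'$ at most $k$ times; if no such $k$ exists, $\mathrm{pind}(A)=\infty$. A total weighting of $G$ is a map $f:V(G)\cup E(G)\to\mathbb{R}$; the vertex sum of $v$ is $\phi_f(v)=f(v)+\sum_{e\in E(v)}f(e)$, where $E(v)$ is the set of edges incident to $v$. It is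 proper if $\phi_f(u)\neq\phi_f(v)$ for every edge $uv$ of $G$. $G$ is $(k,k')$-choosable if for every assignment $L$ of a set $L(v)$ of $k$ real numbers to each vertex $v$ and a set $L(e)$ of $k'$ real numbers to each edge $e$, there is a proper total weighting $f$ with $f(z)\in L(z)$ for all $z\in V(G)\cup E(G)$. *)

(* Defs.v *)
From mathcomp Require Import all_boot all_order all_fingroup all_algebra.
From mathcomp Require Import finmap boolp reals.

Set Implicit Arguments.
Unset Strict Implicit.
Unset Printing Implicit Defensive.

Import GRing.Theory.

Local Open Scope ring_scope.

Record sgraph := SGraph {
  svertex :> finType;
  sedge : rel svertex;
  sedge_sym : symmetric sedge;
  sedge_irrefl : irreflexive sedge }.

(* An edge is the unordered pair of its two end vertices. *)
Definition edges (G : sgraph) : {set {set G}} :=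
  [set [set p.1; p.2] | p : G * G & sedge p.1 p.2].

Definition edge (G : sgraph) := {e : {set G} | e \in edges G}.

(* V(G) \cup E(G), as a disjoint union. *)
Definition velt (G : sgraph) : finType := (G + edge G)%type.

Definition incident (G : sgraph) (e : edge G) (v : G) : bool := v \in val e.

Record orientation (G : sgraph) := Orientation {
  tail : edge G -> G;
  head : edge G -> G;
  orientP : forall e, val e = [set tail e; head e] }.

Lemma orientation_exists (G : sgraph) : inhabited (orientation G).
Proof.
have ex (e : edge G) : exists p : G * G, val e == [set p.1; p.2].
  by case/imsetP: (valP e) => p _ ->; exists p.
by split; apply: (@Orientation G (fun e => (xchoose (ex e)).1)
  (fun e => (xchoose (ex e)).2)) => e; exact/eqP/(xchooseP (ex e)).
Qed.

(* For an end x of e: z is x itself, or an edge other than e incident to x. *)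
Definition meets_at (G : sgraph) (e : edge G) (x : G) (z : velt G) : bool :=
  match z with
  | inl v => v == x
  | inr e' => (e' != e) && incident e' x
  end.

Definition A_entry (R : realType) (G : sgraph) (D : orientation G)
    (e : edge G) (z : velt G) : R :=
  if meets_at e (head D e) z then 1
  else if meets_at e (tail D e) z then -1
  else 0.

(* Rows and columns are numbered through the enumerations of E(G) and of
   V(G) \cup E(G). *)
Definition A_mx (R : realType) (G : sgraph) (D : orientation G) :
    'M[R]_(#|{: edge G}|, #|{: velt G}|) :=
  \matrix_(i, j) A_entry R D (enum_val i) (enum_val j).

Definition per (R : comNzRingType) (m : nat) (A : 'M[R]_m) : R :=
  \sum_(s : 'S_m) \prod_(i < m) A i (s i).

(* The square matrix A' is given by the function c sending the index of each
   of its columns to the index of the column of A it copies. *)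
Definition per_selectable (R : comNzRingType) (m n : nat) (A : 'M[R]_(m, n))
    (k : nat) : bool :=
  [exists c : {ffun 'I_m -> 'I_n},
     (per (colsub c A) != 0) && [forall j, (#|[set i | c i == j]| <= k)%N]].

(* None stands for infinity. *)
Definition pind (R : comNzRingType) (m n : nat) (A : 'M[R]_(m, n)) :
    option nat :=
  match pselect (exists k, (0 < k)%N && per_selectable A k) with
  | left ex_k => Some (ex_minn ex_k)
  | right _ => None
  end.

Definition vertex_sum (R : realType) (G : sgraph) (f : velt G -> R) (v : G) :
    R :=
  f (inl v) + \sum_(e : edge G | incident e v) f (inr e).

Definition proper_weighting (R : realType) (G : sgraph) (f : velt G -> R) :
    Prop :=
  forall u v : G, sedge u v -> vertex_sum f u <> vertex_sum f v.

Definition choosable (R : realType) (G : sgraph) (k k' : nat) : Prop :=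
  forall L : velt G -> {fset R},
    (forall v : G, #|` L (inl v)| = k) ->
    (forall e : edge G, #|` L (inr e)| = k') ->
  exists2 f : velt G -> R,
    proper_weighting f & forall z, f z \in L z.

Definition path_rel (n : nat) : rel 'I_n :=
  fun i j => (j == i.+1 :> nat) || (i == j.+1 :> nat).

Lemma path_rel_sym n : symmetric (@path_rel n).
Proof. by move=> i j; rewrite /path_rel orbC. Qed.

Lemma path_rel_irrefl n : irreflexive (@path_rel n).
Proof. by move=> i; rewrite /path_rel orbb ltn_eqF. Qed.

(* The path on n vertices; the vertices are numbered from 0. *)
Definition path_graph (n : nat) : sgraph :=
  SGraph (@path_rel_sym n) (@path_rel_irrefl n).

Definition box_rel (G H : sgraph) : rel (G * H) :=
  fun p q => ((p.1 == q.1) && sedge p.2 q.2) || (sedge p.1 q.1 && (p.2 == q.2)).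

Lemma box_rel_sym (G H : sgraph) : symmetric (@box_rel G H).
Proof.
by move=> p q; rewrite /box_rel !(eq_sym (q.1), eq_sym (q.2)) !(sedge_sym q.1,
  sedge_sym q.2).
Qed.

Lemma box_rel_irrefl (G H : sgraph) : irreflexive (@box_rel G H).
Proof. by move=> p; rewrite /box_rel !sedge_irrefl andbF. Qed.

(* Cartesian product. *)
Definition box (G H : sgraph) : sgraph :=
  SGraph (@box_rel_sym G H) (@box_rel_irrefl G H).

Definition grid (n m : nat) : sgraph := box (path_graph n) (path_graph m).

(* Main.v *)
Require Import Defs.
From mathcomp Require Import all_boot all_order all_algebra.
From mathcomp Require Import reals.
From mathcomp Require Import all_fingroup finmap boolp zify ring.

Set Implicit Arguments.
Unset Strict Implicit.
Unset Printing Implicit Defensive.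

Import GRing.Theory Num.Theory.

Local Open Scope ring_scope.

(* The column of an edge uv is the sum of the columns of u and v. The grid on
   (n+1)(m+1) points is the grid on nm points together with an L-shaped path,
   attached to it at all its vertices but the corner. The columns of the
   vertices and edges of the path vanish on the rows of the smaller grid, so
   selecting the vertices other than the corner and the edges of each L gives a
   block triangular matrix (when the smaller grid is empty, the vertices other
   than the corner suffice). Eliminating the vertices of an L from both ends
   towards the corner shows that the permanent of a diagonal block is, up to
   sign, a power of 2.

   For (2,2)-choosability, with two values p_z, q_z for each selected z, the
   alternating sum over all choices of the product over the edges ab of
   phi(b) - phi(a) is, up to sign, the permanent times the product of the
   q_z - p_z; it is nonzero, so some choice is proper. *)

(** * Permanents of lists of rows and columns *)

Lemma lift_perm_onto n (s : 'S_n.+1) :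
  {t : 'S_n | s = lift_perm ord0 (s ord0) t}.
Proof.
have lift_ex k : {j | s (lift ord0 k) = lift (s ord0) j}.
  have [j sk|] := unliftP (s ord0) (s (lift ord0 k)); first by exists j.
  by move/perm_inj/eqP; rewrite eq_sym (negPf (neq_lift _ _)).
pose u k := sval (lift_ex k).
have uE k : s (lift ord0 k) = lift (s ord0) (u k) := svalP (lift_ex k).
have u_inj : injective u.
  by move=> k l kl; apply/(@lift_inj _ ord0)/(@perm_inj _ s); rewrite !uE kl.
exists (perm u_inj); apply/permP => k.
have [k' ->|->] := unliftP ord0 k; first by rewrite lift_perm_lift permE uE.
by rewrite lift_perm_id.
Qed.

(** Laplace expansion along the first row: the permutations sending [ord0] to [j] are the
    [lift_perm ord0 j t], and [lift_perm_onto] supplies the inverse of this parametrization. *)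
Lemma big_perm_recl (R : comNzRingType) n (f : 'I_n.+1 -> 'I_n.+1 -> R) :
  \sum_(s : 'S_n.+1) \prod_i f i (s i) =
  \sum_j f ord0 j *
    \sum_(s : 'S_n) \prod_i f (lift ord0 i) (lift j (s i)).
Proof.
rewrite (partition_big (fun s : 'S_n.+1 => s ord0) xpredT) //=.
apply: eq_bigr => j _; rewrite (reindex (lift_perm ord0 j)); last first.
  exists (fun s => sval (lift_perm_onto s)) => [t _|s /eqP <-].
    case: lift_perm_onto => t' /=; rewrite lift_perm_id => /permP tt'.
    apply/permP => k; have := tt' (lift ord0 k).
    by rewrite !lift_perm_lift => /lift_inj.
  by case: lift_perm_onto.
rewrite big_distrr /=; apply: eq_big => s; first by rewrite lift_perm_id eqxx.
move=> _; rewrite big_ord_recl lift_perm_id; congr (_ * _).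
by apply: eq_bigr => i _; rewrite lift_perm_lift.
Qed.

Definition remat T (s : seq T) i := take i s ++ drop i.+1 s.

Lemma size_remat T (s : seq T) i :
  (i < size s)%N -> size (remat s i) = (size s).-1.
Proof. by move=> lti; rewrite size_cat size_take size_drop lti; lia. Qed.

Lemma nth_remat T (x0 : T) s i j :
  (i < size s)%N -> nth x0 (remat s i) j = nth x0 s (bump i j).
Proof.
move=> lti; rewrite nth_cat size_take lti /bump.
case: (ltnP j i) => ij; first by rewrite nth_take.
by rewrite nth_drop addSn subnKC.
Qed.

Lemma remat_catl T (s t : seq T) i :
  (i < size s)%N -> remat (s ++ t) i = remat s i ++ t.
Proof.
move=> lti; rewrite /remat take_cat drop_cat lti; case: ltnP => [_|les].
  by rewrite catA.
have -> : i.+1 = size s by lia.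
by rewrite subnn drop0 drop_size cats0.
Qed.

Lemma mem_remat (T : eqType) (s : seq T) i : {subset remat s i <= s}.
Proof. by move=> x; rewrite mem_cat => /orP[/mem_take|/mem_drop]. Qed.

(* The permanent of the matrix (B r c), with rows and columns listed. *)
Fixpoint lper (R : comNzRingType) (I J : Type) (B : I -> J -> R)
    (rs : seq I) (cs : seq J) : R :=
  if rs is r :: rs' then
    \sum_(j < size cs) B r (tnth (in_tuple cs) j) * lper B rs' (remat cs j)
  else (size cs == 0)%:R.

Section ListPermanent.
Variables (R : comNzRingType).
Implicit Types I J : eqType.

(** Left-over columns give 0 by the base case of [lper], left-over rows by an empty sum. Hence
    reordering and transposition need no hypothesis on sizes. *)
Lemma lper_size (I J : Type) (B : I -> J -> R) rs cs :
  size rs != size cs -> lper B rs cs = 0.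
Proof.
elim: rs cs => [|r rs IH] cs /=; first by rewrite eq_sym => /negPf ->.
move=> szN; apply: big1 => j _; rewrite IH ?mulr0 //.
by rewrite size_remat; have := ltn_ord j; lia.
Qed.

Lemma lper_cons (I J : Type) (y0 : J) (B : I -> J -> R) r rs cs :
  lper B (r :: rs) cs =
  \sum_(j < size cs) B r (nth y0 cs j) * lper B rs (remat cs j).
Proof. by apply: eq_bigr => j _; rewrite (tnth_nth y0). Qed.

Lemma lperE (I J : Type) (x0 : I) (y0 : J) (B : I -> J -> R) n rs cs :
    size rs = n -> size cs = n ->
  lper B rs cs =
  \sum_(s : 'S_n) \prod_(i < n) B (nth x0 rs i) (nth y0 cs (s i)).
Proof.
move=> szr szc; elim: rs n szr cs szc => [|r rs IH] n <- cs.
  move/size0nil->; rewrite (eq_bigr (fun=> 1)) => [|s _]; last exact: big_ord0.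
  by rewrite sumr_const (eq_card (B := 'S_0)) ?card_Sn.
rewrite [size _]/= => szc.
rewrite (big_perm_recl (fun i j => B (nth x0 (r :: rs) i) (nth y0 cs j))).
rewrite (lper_cons y0) szc; apply: eq_bigr => j _; congr (_ * _).
have ltj : (j < size cs)%N by rewrite szc.
rewrite (IH (size rs)) ?size_remat ?szc //.
by do 2![apply: eq_bigr => ? _]; rewrite nth_remat.
Qed.

Lemma lper_perm_cols (I : Type) J (B : I -> J -> R) rs cs cs' :
  perm_eq cs cs' -> lper B rs cs = lper B rs cs'.
Proof.
move=> pcs; have szcs := perm_size pcs.
have [szr|] := eqVneq (size rs) (size cs'); last first.
  by move=> neq; rewrite !lper_size // szcs.
case: rs szr => [|r rs] szr; first by rewrite /= szcs.
case: cs' => [|c cs'] // in pcs szcs szr *.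
rewrite (lperE r c B szr szcs) (lperE r c B szr erefl).
have /tuple_permP [p ->] : perm_eq cs (in_tuple (c :: cs')) by [].
rewrite (reindex_inj (mulIg p^-1)%g); apply: eq_bigr => s _.
apply: eq_bigr => i _; congr (B _ _).
by rewrite -tnth_nth tnth_mktuple permM permKV (tnth_nth c).
Qed.

Lemma lper_tr (I J : Type) (B : I -> J -> R) rs cs :
  lper B rs cs = lper (fun j i => B i j) cs rs.
Proof.
have [szr|neq] := eqVneq (size rs) (size cs); last first.
  by rewrite !lper_size // eq_sym.
case: rs cs szr => [|r rs] [|c cs] // szr.
rewrite (lperE r c _ szr erefl) (lperE c r _ erefl szr).
rewrite (reindex_inj invg_inj); apply: eq_bigr => s _.
by rewrite (reindex_inj (@perm_inj _ s)); apply: eq_bigr => i _; rewrite permK.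
Qed.

Lemma lper_perm_rows I (J : Type) (B : I -> J -> R) rs rs' cs :
  perm_eq rs rs' -> lper B rs cs = lper B rs' cs.
Proof. by move=> prs; rewrite !(lper_tr B); apply: lper_perm_cols. Qed.

Lemma lper_perm I J (B : I -> J -> R) rs rs' cs cs' :
  perm_eq rs rs' -> perm_eq cs cs' -> lper B rs cs = lper B rs' cs'.
Proof. by move=> /lper_perm_rows -> /lper_perm_cols ->. Qed.

(** Linearity in the first row is enough, since [lper_perm_rows] brings any row to the front. *)
Lemma lper_row (I : Type) J (B : I -> J -> R) k r r1 r2 rs cs :
    {in cs, forall c, B r c = B r1 c + k * B r2 c} ->
  lper B (r :: rs) cs = lper B (r1 :: rs) cs + k * lper B (r2 :: rs) cs.
Proof.
move=> Br; rewrite /= big_distrr -big_split /=; apply: eq_bigr => j _.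
by rewrite Br ?mem_tnth // mulrDl mulrA.
Qed.

Lemma lper_col I (J : Type) (B : I -> J -> R) k c c1 c2 rs cs :
    {in rs, forall r, B r c = B r c1 + k * B r c2} ->
  lper B rs (c :: cs) = lper B rs (c1 :: cs) + k * lper B rs (c2 :: cs).
Proof. by rewrite !(lper_tr B); apply: lper_row. Qed.

Lemma lper_map (I J T U : Type) (B : I -> J -> R) (f : T -> I) (g : U -> J)
    ts us :
  lper B (map f ts) (map g us) = lper (fun t u => B (f t) (g u)) ts us.
Proof.
have [szt|neq] := eqVneq (size ts) (size us); last first.
  by rewrite !lper_size ?size_map.
case: ts us szt => [|t ts] [|u us] // szt.
rewrite (lperE (f t) (g u) B (n := size (u :: us))) ?size_map //.
rewrite (lperE t u _ szt erefl).
apply: eq_bigr => s _; apply: eq_bigr => i _.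
by rewrite (nth_map t) ?(nth_map u) // szt.
Qed.

Lemma lper_scale I J (B B' : I -> J -> R) (e : I -> R) rs cs :
    {in rs & cs, forall r c, B r c = e r * B' r c} ->
  lper B rs cs = (\prod_(r <- rs) e r) * lper B' rs cs.
Proof.
elim: rs cs => [|r rs IH] cs BB'; first by rewrite big_nil mul1r.
rewrite big_cons /= big_distrr; apply: eq_bigr => j _ /=.
rewrite IH => [|r' c rr' /mem_remat cc]; last by rewrite BB' ?inE ?rr' ?orbT.
by rewrite BB' ?mem_head ?mem_tnth //; ring.
Qed.

(* Since the rows R1 vanish on C0, they have to be matched with C1. *)
Lemma lper_block I J (B : I -> J -> R) R1 R0 C1 C0 :
    {in R1 & C0, forall r c, B r c = 0} -> (size C1 <= size R1)%N ->
  lper B (R1 ++ R0) (C1 ++ C0) = lper B R1 C1 * lper B R0 C0.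
Proof.
elim: R1 C1 => [|r R1 IH] C1 B0 szC.
  by move: szC; rewrite leqn0 => /nilP ->; rewrite mul1r.
(* A default column for [nth] exists unless both column lists are empty. *)
have [y0|J0] : J + (C1 ++ C0 = [::]) by case: (C1 ++ C0) => [|y]; [right|left].
  rewrite !(lper_cons y0) size_cat big_split_ord /=.
  rewrite [X in _ + X]big1 ?addr0 => [|j _]; last first.
    rewrite nth_cat ltnNge leq_addr /= addKn.
    by rewrite B0 ?mul0r ?mem_head // mem_nth.
  rewrite big_distrl /=; apply: eq_bigr => j _.
  have ltj := ltn_ord j; rewrite nth_cat ltj remat_catl // IH ?mulrA //.
    by move=> i c iR; apply: B0; rewrite inE iR orbT.
  by rewrite size_remat //; move: szC => /=; lia.
by case: C1 C0 J0 {IH B0 szC} => [|//] [|//] _; rewrite /= !big_ord0 mul0r.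
Qed.

Lemma lper_nseq I J (B : I -> J -> R) r c a :
  B r c = 1 -> lper B (nseq a r) (nseq a c) = a`!%:R.
Proof.
move=> B1; rewrite (lperE r c _ (size_nseq a r) (size_nseq a c)).
rewrite (eq_bigr (fun=> 1)) => [|s _]; first by rewrite sumr_const -card_Sn.
by rewrite big1 // => i _; rewrite !nth_nseq !if_same.
Qed.

End ListPermanent.

(** * Incidence permanents *)

(* inl v stands for a vertex and inr (u, v) for an edge. As a column, inr (u, v)
   is the sum of the columns of u and v; as a row, it is the difference of the
   unit rows of u and v. *)
Definition vsym (V : eqType) : eqType := (V + V * V)%type.

Section Incidence.
Variables (R : comNzRingType) (V : eqType).
Implicit Types (u v x y : V) (c r : vsym V).

Definition inc c u : R :=
  match c with
  | inl v => (u == v)%:R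
  | inr p => (u == p.1)%:R + (u == p.2)%:R
  end.

Definition vpair r c : R :=
  match r with
  | inl u => inc c u
  | inr p => inc c p.1 - inc c p.2
  end.

(** A syntactic condition that makes the entry at [x] vanish, for a symbol used as a column
    ([inc_avoids]) or as a row ([vpair_avoids]). *)
Definition avoids x c : bool :=
  match c with
  | inl v => v != x
  | inr p => (p.1 != x) && (p.2 != x)
  end.

Lemma inc_avoids x c : avoids x c -> inc c x = 0.
Proof.
case: c => [v|p] /=; first by rewrite eq_sym => /negPf ->.
by case/andP; rewrite !(eq_sym _ x) => /negPf -> /negPf ->; rewrite addr0.
Qed.

Lemma vpair_avoids x r : avoids x r -> vpair r (inl x) = 0.
Proof.
case: r => [v|p] /=; first by move/negPf ->.
by case/andP => /negPf -> /negPf ->; rewrite subr0.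
Qed.

Lemma vpairxx x : vpair (inl x) (inl x) = 1.
Proof. by rewrite /= eqxx. Qed.

(** The rows [inl x] vanish on [CS], so the matrix is block triangular, and the block of the copies
    of [x] is all ones. *)
Lemma lper_vertex x a RS CS : all (avoids x) CS ->
  lper vpair (nseq a (inl x) ++ RS) (nseq a (inl x) ++ CS) =
  a`!%:R * lper vpair RS CS.
Proof.
move=> /allP xCS; rewrite lper_block ?size_nseq ?(lper_nseq _ (vpairxx x)) //.
by move=> r c; rewrite mem_nseq => /andP[_ /eqP ->] /xCS/inc_avoids.
Qed.

(** The [a] rows [inl x] vanish outside [b] columns, too few to match them all. *)
Lemma lper_vertex_gt x a b RS CS : (b < a)%N -> all (avoids x) CS ->
  lper vpair (nseq a (inl x) ++ RS) (nseq b (inl x) ++ CS) = 0.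
Proof.
move=> ltba /allP xCS; rewrite lper_block ?size_nseq ?(ltnW ltba) //.
  by rewrite lper_size ?mul0r // !size_nseq; lia.
by move=> r c; rewrite mem_nseq => /andP[_ /eqP ->] /xCS/inc_avoids.
Qed.

Lemma lper_vertex_lt x a b RS CS : (a < b)%N -> all (avoids x) RS ->
  lper vpair (nseq a (inl x) ++ RS) (nseq b (inl x) ++ CS) = 0.
Proof.
move=> ltab /allP xRS; rewrite lper_tr lper_block ?size_nseq ?(ltnW ltab) //.
  by rewrite lper_size ?mul0r // !size_nseq; lia.
by move=> c r; rewrite mem_nseq => /andP[_ /eqP ->] /xRS/vpair_avoids.
Qed.

(** Split the row of the edge as [x] minus [y] and its column as [x] plus [y]. In the two mixed
    terms [x] occurs unequally often as a row and as a column, so they vanish; in the other two the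
    copies of [x] factor out as a factorial. *)
Lemma lper_step x y a RS CS :
    x != y -> all (avoids x) RS -> all (avoids x) CS ->
  lper vpair (nseq a (inl x) ++ inr (x, y) :: RS)
             (nseq a (inl x) ++ inr (x, y) :: CS) =
  a.+1`!%:R * lper vpair RS CS -
  a`!%:R * lper vpair (inl y :: RS) (inl y :: CS).
Proof.
move=> neqxy xRS xCS; pose X b := nseq b (inl x : vsym V).
have rot b z S : perm_eq (z :: X b ++ S) (X b ++ z :: S).
  by rewrite -cat1s perm_catCA.
have neqyx : y != x by rewrite eq_sym.
rewrite -!(lper_perm _ (rot _ _ _) (rot _ _ _)).
rewrite (@lper_row _ _ _ _ (-1) _ (inl x) (inl y)); last by move=> c _ /=; ring.
rewrite !(@lper_col _ _ _ _ 1 (inr (x, y)) (inl x) (inl y));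
  try by move=> [u|p] _ /=; ring.
have -> := lper_vertex a.+1 RS xCS.
rewrite (lper_perm_cols _ (inl x :: _) (rot a (inl y) CS)).
rewrite (lper_perm_rows _ (inl x :: _) (rot a (inl y) RS)).
have -> := @lper_vertex_gt x a.+1 a RS (inl y :: CS) (ltnSn a).
  have -> := @lper_vertex_lt x a a.+1 (inl y :: RS) CS (ltnSn a).
    rewrite (lper_perm _ (rot a (inl y) RS) (rot a (inl y) CS)).
    by rewrite lper_vertex /= ?neqyx //; ring.
  by rewrite /= neqyx.
by rewrite /= neqyx.
Qed.

(** Each vertex stands just before its edge, the shape that [lper_step] consumes. The end point
    [f (i + k)] is not listed as a vertex. *)
Definition arm (f : nat -> V) i k : seq (vsym V) :=
  flatten [seq [:: inl (f j); inr (f j, f j.+1)] | j <- iota i k].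

Lemma arm_avoids (f : nat -> V) x i k :
  (forall j, (i <= j <= i + k)%N -> f j != x) -> all (avoids x) (arm f i k).
Proof.
rewrite /arm; elim: k i => [|k IH] i //= fx.
rewrite !fx ?IH //; try lia.
by move=> j ij; apply: fx; lia.
Qed.

(* Eliminating the vertices of the arm two at a time, each pair contributes -2:
   this is M ^+ 2 = -2 for the transfer matrix M = [[2, -1], [6, -2]]. *)
Lemma lper_arm (f : nat -> V) k i RS CS : injective f ->
    (forall j, (i <= j < i + k)%N -> all (avoids (f j)) RS) ->
    (forall j, (i <= j < i + k)%N -> all (avoids (f j)) CS) ->
  lper vpair (arm f i k ++ RS) (arm f i k ++ CS) =
  (-2) ^+ k./2 *
  if odd k then
    2 * lper vpair RS CS -
    lper vpair (inl (f (i + k)%N) :: RS) (inl (f (i + k)%N) :: CS)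
  else lper vpair RS CS.
Proof.
move=> f_inj; have [h] := ubnP k; elim: h k i => // h IH [|[|k]] i ltk fRS fCS.
- by rewrite /= mul1r.
- have /= := @lper_step (f i) (f i.+1) 1 RS CS.
  rewrite expr0 mul1r addn1 => -> //; first by rewrite mul1r.
  + by rewrite (inj_eq f_inj); lia.
  + by apply: fRS; lia.
  + by apply: fCS; lia.
have stepS a j l : (i <= j)%N -> (j + l < i + k.+2)%N ->
    lper vpair (nseq a (inl (f j)) ++ inr (f j, f j.+1) :: arm f j.+1 l ++ RS)
               (nseq a (inl (f j)) ++ inr (f j, f j.+1) :: arm f j.+1 l ++ CS) =
    a.+1`!%:R * lper vpair (arm f j.+1 l ++ RS) (arm f j.+1 l ++ CS) -
    a`!%:R * lper vpair (inl (f j.+1) :: arm f j.+1 l ++ RS)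
                        (inl (f j.+1) :: arm f j.+1 l ++ CS).
  move=> leij ltj; rewrite lper_step //.
  - by rewrite (inj_eq f_inj); lia.
  - rewrite all_cat fRS ?andbT; last by lia.
    by apply: arm_avoids => j' ?; rewrite (inj_eq f_inj); lia.
  - rewrite all_cat fCS ?andbT; last by lia.
    by apply: arm_avoids => j' ?; rewrite (inj_eq f_inj); lia.
(* The first elimination leaves either one or two copies of the second vertex, hence the
   multiplicities 1 and 2 below. The total is 2(2A - B) - (6A - 2B) = -2A, where B carries an extra
   copy of the third vertex. *)
have /= -> := stepS 1 i k.+1 (leqnn _) ltac:(lia).
have /= -> := stepS 1 i.+1 k (leqnSn _) ltac:(lia).
have /= -> := stepS 2 i.+1 k (leqnSn _) ltac:(lia).
rewrite IH => [|||j ?]; [|lia|move=> j ?; apply: fRS; lia|apply: fCS; lia].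
rewrite negbK exprS !addSnnS -[3`!]/6%N -[2`!]/2%N -[1`!]/1%N.
by case: ifP => _; ring.
Qed.
End Incidence.

Arguments vpair R {V}.

(** * Selected columns of the grid *)

Lemma lper_two_arms (R : numDomainType) (n m : nat) :
  let S : seq (vsym (nat * nat)%type) :=
    arm (pair n) 0 m ++ arm (pair^~ m) 0 n in
  lper (vpair R) S S != 0.
Proof.
pose f (j : nat) := (n, j); pose g (i : nat) := (i, m) => /=; rewrite -/f -/g.
have f_inj : injective f by move=> j k [].
have g_inj : injective g by move=> j k [].
have fg j : (0 <= j < 0 + m)%N -> all (avoids (f j)) (arm g 0 n).
  by move=> ltj; apply: arm_avoids => i _; rewrite xpair_eqE; lia.
have gc i : (0 <= i < 0 + n)%N -> all (avoids (g i)) [:: inl (n, m)].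
  by move=> lti; rewrite /= xpair_eqE; lia.
(* Eliminating the first arm leaves the second one, with or without an extra copy of the corner
   [f m = g n]. That copy is moved to the end so that [lper_arm] applies again. *)
rewrite lper_arm // !add0n -/(f m).
have rot : perm_eq (inl (f m) :: arm g 0 n) (arm g 0 n ++ [:: inl (f m)]).
  by rewrite -cat1s perm_catC.
rewrite (lper_perm _ rot rot) -[arm g 0 n in X in 2 * X]cats0.
rewrite -[arm g 0 n in X in if _ then _ else X]cats0.
rewrite !lper_arm // add0n.
have c1 : lper (vpair R) [:: inl (f m)] [:: inl (f m)] = 1.
  exact: (lper_nseq 1 (vpairxx R _)).
have c2 :
    lper (vpair R) [:: inl (f m); inl (f m)] [:: inl (f m); inl (f m)] = 2.
  exact: (lper_nseq 2 (vpairxx R _)).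
rewrite -[g n]/(f m) c1 c2 /=.
have p0 k : (-2) ^+ k != 0 :> R by rewrite expf_neq0 // oppr_eq0 pnatr_eq0.
apply: mulf_neq0 => //; move: (p0 n./2); move: (_ ^+ n./2) => p p_neq0.
(* Beside the powers of -2, the factor is 2 if [m] and [n] are both odd, and 1 otherwise. *)
case: ifP => _; case: ifP => _; rewrite ?mulr1 //.
- have -> : 2 * (p * (2 - 1)) - p * (2 - 2) = 2 * p by ring.
  by rewrite mulf_neq0 ?pnatr_eq0.
- by have -> : 2 * p - p = p by ring.
- by have -> : p * (2 - 1) = p by ring.
Qed.

Definition segs (f : nat -> nat * nat) k := [seq (f j, f j.+1) | j <- iota 0 k].

(* Edges lead to the larger end. The last lists are the edges joining the
   L-shaped path of the points (n, j) and (i, m) to the smaller grid. *)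
Definition level n m : seq ((nat * nat) * (nat * nat)) :=
  segs (pair n) m ++ segs (pair^~ m) n ++
  (if n is n'.+1 then [seq ((n', j), (n, j)) | j <- iota 0 m] else [::]) ++
  (if m is m'.+1 then [seq ((i, m'), (i, m)) | i <- iota 0 n] else [::]).

(** The case distinction keeps the block square: [level n m] has 2(n + m) edges if [n] and [m] are
    positive, and only n + m otherwise. *)
Definition level_cols n m : seq (vsym (nat * nat)%type) :=
  [seq inl (n, j) | j <- iota 0 m] ++ [seq inl (i, m) | i <- iota 0 n] ++
  (if (0 < n)%N && (0 < m)%N then map inr (segs (pair n) m ++ segs (pair^~ m) n)
   else [::]).

Fixpoint grid_rows n m : seq ((nat * nat) * (nat * nat)) :=
  match n, m with
  | n'.+1, m'.+1 => level n' m' ++ grid_rows n' m'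
  | _, _ => [::]
  end.

Fixpoint grid_cols n m : seq (vsym (nat * nat)%type) :=
  match n, m with
  | n'.+1, m'.+1 => level_cols n' m' ++ grid_cols n' m'
  | _, _ => [::]
  end.

Definition grid_step (p : (nat * nat) * (nat * nat)) : bool :=
  ((p.1.1 == p.2.1) && (p.2.2 == p.1.2.+1)) ||
  ((p.2.1 == p.1.1.+1) && (p.1.2 == p.2.2)).

(** Trades membership for a boolean [P] in which the index is solved for, so that [lia] can take
    over. *)
Lemma mem_map_iota (T : eqType) (F : nat -> T) k x (P : bool) (i : nat) :
    (P -> (i < k)%N /\ x = F i) -> (forall j, (j < k)%N -> x = F j -> P) ->
  (x \in [seq F j | j <- iota 0 k]) = P.
Proof.
move=> PF FP; apply/mapP/idP => [[j]|/PF[ltik ->]].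
  by rewrite mem_iota => /andP[_ ltj]; apply: FP.
by exists i; rewrite ?mem_iota.
Qed.

(** Reduces disjointness and coverage of the levels to arithmetic on the larger end of an edge. *)
Lemma mem_level n m a b c d :
  (((a, b), (c, d)) \in level n m) =
  [&& grid_step ((a, b), (c, d)), (c <= n)%N, (d <= m)%N &
      (c == n) || (d == m)].
Proof.
rewrite !mem_cat /grid_step /=.
rewrite (@mem_map_iota _ _ _ _ [&& a == n, c == n, d == b.+1 & (b < m)%N] b);
  first last.
- by move=> j ? [-> -> -> ->]; rewrite !eqxx.
- by case/and4P => /eqP -> /eqP -> /eqP ->.
rewrite (@mem_map_iota _ _ _ _ [&& b == m, d == m, c == a.+1 & (a < n)%N] a);
  first last.
- by move=> j ? [-> -> -> ->]; rewrite !eqxx.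
- by case/and4P => /eqP -> /eqP -> /eqP ->.
have -> : (((a, b), (c, d)) \in if n is n'.+1 then
    [seq ((n', j), (n, j)) | j <- iota 0 m] else [::]) =
  [&& a.+1 == n, c == n, d == b & (b < m)%N].
  case: n => [|n]; first by rewrite in_nil.
  apply: (@mem_map_iota _ _ _ _ _ b); last first.
    by move=> j ? [-> -> -> ->]; rewrite !eqxx.
  by case/and4P => /eqP[->] /eqP -> /eqP ->.
have -> : (((a, b), (c, d)) \in if m is m'.+1 then
    [seq ((i, m'), (i, m)) | i <- iota 0 n] else [::]) =
  [&& b.+1 == m, d == m, c == a & (a < n)%N].
  case: m => [|m]; first by rewrite in_nil.
  apply: (@mem_map_iota _ _ _ _ _ a); last first.
    by move=> j ? [-> -> -> ->]; rewrite !eqxx.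
  by case/and4P => /eqP[->] /eqP -> /eqP ->.
lia.
Qed.

Lemma mem_grid_rows n m a b c d :
  (((a, b), (c, d)) \in grid_rows n m) =
  [&& grid_step ((a, b), (c, d)), (c < n)%N & (d < m)%N].
Proof.
elim: n m => [|n IH] [|m] /=; rewrite ?ltn0 ?andbF //.
by rewrite mem_cat mem_level IH; case: (grid_step _) => //=; lia.
Qed.

Lemma uniq_map_iota (T : eqType) (F : nat -> T) k :
  injective F -> uniq [seq F j | j <- iota 0 k].
Proof. by move=> F_inj; rewrite map_inj_uniq ?iota_uniq. Qed.

Lemma cat_uniqI (T : eqType) (s t : seq T) :
  uniq s -> uniq t -> {in t, forall x, x \notin s} -> uniq (s ++ t).
Proof. by move=> us ut st; rewrite cat_uniq us ut andbT; apply/hasPn. Qed.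

Lemma uniq_level n m : uniq (level n m).
Proof.
have F1 : injective (fun j => ((n, j), (n, j.+1))) by move=> j k [].
have F2 : injective (fun i => ((i, m), (i.+1, m))) by move=> j k [].
apply: cat_uniqI; [exact: uniq_map_iota| |].
  apply: cat_uniqI; [exact: uniq_map_iota| |].
    apply: cat_uniqI.
    - by case: (n) => // n'; apply: uniq_map_iota => j k [].
    - by case: (m) => // m'; apply: uniq_map_iota => j k [].
    - move=> x; case: m {F2} => // m /mapP[i]; rewrite mem_iota => lti ->.
      case: n lti {F1} => // n lti; apply/mapP => -[j].
      by rewrite mem_iota => ltj [=]; lia.
  move=> x xL; apply/mapP => -[i]; rewrite mem_iota => lti Ex.
  move: xL; rewrite {}Ex mem_cat => /orP[].
    by case: n lti {F1} => // n lti /mapP[j]; rewrite mem_iota => ltj [=]; lia.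
  by case: m {F2} => // m /mapP[j]; rewrite mem_iota => ltj [=]; lia.
move=> x xL; apply/mapP => -[j]; rewrite mem_iota => ltj Ex.
move: xL; rewrite {}Ex !mem_cat => /or3P[].
- by case/mapP => i; rewrite mem_iota => lti [=]; lia.
- by case: n {F1} => // n /mapP[i]; rewrite mem_iota => lti [=]; lia.
- by case: m ltj {F2} => // m ltj /mapP[i]; rewrite mem_iota => lti [=]; lia.
Qed.

Lemma uniq_grid_rows n m : uniq (grid_rows n m).
Proof.
elim: n m => [|n IH] [|m] //=; apply: cat_uniqI; [exact: uniq_level|exact: IH|].
by move=> [[a b] [c d]]; rewrite mem_grid_rows mem_level; lia.
Qed.

Lemma size_grid n m : size (grid_cols n m) = size (grid_rows n m).
Proof.
elim: n m => [|n IH] [|m] //=; rewrite !size_cat IH; congr addn.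
rewrite !size_map !size_iota; case: n {IH} => [|n]; case: m => [|m] //=.
all: by rewrite ?(size_map, size_cat, size_iota) /= ?addn0 ?addnS; lia.
Qed.

Definition point_in n m (p : nat * nat) := (p.1 < n)%N && (p.2 < m)%N.

Lemma mem_level_cols n m x : x \in level_cols n m ->
  match x with
  | inl p => point_in n.+1 m.+1 p && ~~ point_in n m p
  | inr p => p \in level n m
  end.
Proof.
rewrite !mem_cat => /or3P[||].
- by case/mapP => j; rewrite mem_iota => ltj ->; rewrite /point_in /=; lia.
- by case/mapP => j; rewrite mem_iota => ltj ->; rewrite /point_in /=; lia.
case: ifP => // _ /mapP[p pL ->].
by rewrite /level catA mem_cat pL.
Qed.

Lemma mem_grid_cols n m x : x \in grid_cols n m ->
  match x with
  | inl p => point_in n m p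
  | inr p => p \in grid_rows n m
  end.
Proof.
elim: n m => [|n IH] [|m] //=; rewrite mem_cat => /orP[/mem_level_cols|/IH].
  by case: x {IH} => [p /andP[]|p pL] //; rewrite mem_cat pL.
case: x {IH} => [p|p pL]; last by rewrite mem_cat pL orbT.
by rewrite /point_in; lia.
Qed.

Lemma uniq_grid_cols n m : uniq (grid_cols n m).
Proof.
elim: n m => [|n IH] [|m] //=; apply: cat_uniqI; [|exact: IH|]; last first.
  move=> x /mem_grid_cols; case: x => [p pin|[[a b] [c d]] pin].
    by apply/negP => /mem_level_cols; rewrite pin andbF.
  apply/negP => /mem_level_cols; move: pin; rewrite mem_grid_rows mem_level.
  by lia.
apply: cat_uniqI; [by apply: uniq_map_iota => j k []| |].
  apply: cat_uniqI; [by apply: uniq_map_iota => j k []| |].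
    case: ifP => // _; rewrite map_inj_uniq => [|p q [] //].
    by move: (uniq_level n m); rewrite /level catA cat_uniq => /andP[].
  move=> x; case: ifP => // _ /mapP[p _ ->].
  by apply/mapP => -[].
move=> x; rewrite mem_cat => /orP[].
  case/mapP => i; rewrite mem_iota => lti ->.
  by apply/mapP => -[j]; rewrite mem_iota => ltj [=]; lia.
by case: ifP => // _ /mapP[p _ ->]; apply/mapP => -[].
Qed.

(** Serves twice: these columns vanish on the rows of the smaller grid, and in [lper_level] the
    inner end of a connecting edge contributes nothing. *)
Lemma level_cols_avoids n m x p :
  x \in level_cols n m -> point_in n m p -> avoids p x.
Proof.
case: p => a b + /andP[/= lta ltb]; rewrite !mem_cat => /or3P[].
- by case/mapP => j _ -> /=; rewrite xpair_eqE; lia.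
- by case/mapP => i _ -> /=; rewrite xpair_eqE; lia.
case: ifP => // _ /mapP[p + ->]; rewrite mem_cat => /orP[] /mapP[j _ ->] /=;
  by rewrite !xpair_eqE; lia.
Qed.

(** Passes from vertices followed by edges to the alternating order of [arm]. *)
Lemma perm_interleave (T U : eqType) (F G : U -> T) (s : seq U) :
  perm_eq (map F s ++ map G s) (flatten [seq [:: F x; G x] | x <- s]).
Proof.
elim: s => //= x s IH; rewrite perm_cons -cat1s perm_catCA /= perm_cons.
exact: IH.
Qed.

(** The matrix is triangular with unit diagonal: no later edge contains the first vertex. Moving the
    first row and column to the end puts it in the form of [lper_block]. *)
Lemma lper_path (R : comNzRingType) (V : eqType) (f : nat -> V) i k :
    injective f ->
  lper (vpair R) [seq inr (f j, f j.+1) | j <- iota i k]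
                 [seq inl (f j) | j <- iota i k] = 1.
Proof.
move=> f_inj; elim: k i => [|k IH] i //.
rewrite -[iota i _]/(i :: iota i.+1 k) !map_cons.
set Rs := map _ _; set Cs := map _ _.
have rot x (S : seq (vsym V)) : perm_eq (x :: S) (S ++ [:: x]).
  by rewrite -cat1s perm_catC.
rewrite (lper_perm _ (rot _ _) (rot _ _)) lper_block ?size_map ?size_iota //.
  rewrite IH mul1r /= big_ord1 (tnth_nth (inl (f i))) /= eqxx mulr1.
  by rewrite (inj_eq f_inj) (gtn_eqF (ltnSn i)) subr0.
move=> r c /mapP[j]; rewrite mem_iota => ltij ->; rewrite inE => /eqP -> /=.
by rewrite !(inj_eq f_inj) !gtn_eqF ?subrr //; lia.
Qed.

Lemma lper_level (R : numDomainType) n m :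
  lper (vpair R) (map inr (level n m)) (level_cols n m) != 0.
Proof.
have nz x : x = 1 -> x != 0 :> R by move=> ->; apply: oner_neq0.
(* If [n] or [m] is 0, the level is a single path. *)
case: n => [|n].
  rewrite /level /level_cols /= (_ : (if _ is _.+1 then _ else _) = [::]);
    last by case: m.
  rewrite !cats0 -map_comp; apply: nz.
  by apply: (@lper_path R _ (pair 0%N) 0 m) => j k [].
case: m => [|m].
  rewrite /level /level_cols /= !cats0 -map_comp; apply: nz.
  by apply: (@lper_path R _ (pair^~ 0%N) 0 n.+1) => j k [].
(* On the columns of the level, the row of a connecting edge is minus the unit row of its outer end
   [r.2]. After this replacement, with signs [e], rows and columns both list the two arms. *)
pose g r : vsym (nat * nat)%type :=
  if point_in n.+1 m.+1 r.1 then inl r.2 else inr r.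
pose e (r : (nat * nat) * (nat * nat)) : R :=
  if point_in n.+1 m.+1 r.1 then -1 else 1.
rewrite -[level_cols _ _]map_id lper_map.
rewrite (@lper_scale _ _ _ _ (fun r => vpair R (g r)) e).
  rewrite mulf_neq0 ?prodf_seq_neq0 //.
    by apply/allP => r _; rewrite /e; case: ifP; rewrite ?oppr_eq0 oner_neq0.
  rewrite -(lper_map (vpair R) g id) map_id.
  have armP (f : nat -> nat * nat) k : perm_eq
      ([seq inl (f j) | j <- iota 0 k] ++ map inr (segs f k)) (arm f 0 k).
    by rewrite -map_comp perm_interleave.
  have pL : perm_eq (map g (level n.+1 m.+1))
      (arm (pair n.+1) 0 m.+1 ++ arm (pair^~ m.+1) 0 n.+1).
    have -> : map g (level n.+1 m.+1) = map inr (segs (pair n.+1) m.+1) ++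
        map inr (segs (pair^~ m.+1) n.+1) ++
        [seq inl (n.+1, j) | j <- iota 0 m.+1] ++
        [seq inl (i, m.+1) | i <- iota 0 n.+1].
      rewrite /level !map_cat -!map_comp; congr (_ ++ (_ ++ (_ ++ _)));
        apply/eq_in_map => j; rewrite mem_iota /g /point_in /= => ltj.
      - by rewrite ltnn.
      - by rewrite ltnn andbF.
      - by rewrite ltnSn ltj.
      - by rewrite ltnSn andbT ltj.
    apply: (perm_trans _ (perm_cat (armP _ _) (armP _ _))).
    by apply/seq.permP => q; rewrite !count_cat; lia.
  have pC : perm_eq (level_cols n.+1 m.+1)
      (arm (pair n.+1) 0 m.+1 ++ arm (pair^~ m.+1) 0 n.+1).
    apply: (perm_trans _ (perm_cat (armP _ _) (armP _ _))).
    rewrite /level_cols; apply/seq.permP => q.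
    by rewrite map_cat !count_cat; lia.
  by rewrite (lper_perm _ pL pC); apply: lper_two_arms.
move=> r c _ xC; rewrite /g /e; case: ifP => [r_in|_]; last by rewrite mul1r.
by rewrite /= (inc_avoids R (level_cols_avoids xC r_in)) sub0r mulN1r.
Qed.

Lemma lper_grid (R : numDomainType) n m :
  lper (vpair R) (map inr (grid_rows n m)) (grid_cols n m) != 0.
Proof.
elim: n m => [|n IH] [|m] /=; rewrite ?oner_eq0 //.
(* The smaller grid is put first, since its rows are the ones that vanish on the columns of the
   level. *)
rewrite map_cat (lper_perm _ (permEl (perm_catC _ _)) (permEl (perm_catC _ _))).
rewrite lper_block ?size_map ?size_grid //.
  by rewrite mulf_neq0 ?IH ?lper_level.
move=> _ x /mapP[[[a b] [c d]] + ->] xC; rewrite mem_grid_rows.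
case/and3P => st ltc ltd.
rewrite /= !inc_avoids ?subrr //; apply: level_cols_avoids xC _;
  by move: st; rewrite /grid_step /point_in /=; lia.
Qed.

(** * Transfer to the matrix of the grid *)

Section Orientation.
Variables (R : realType) (G : sgraph) (D : orientation G).
Implicit Types (e : edge G) (z : velt G) (v : G).

Lemma mem_edge e v : (v \in val e) = (v == Defs.head D e) || (v == tail D e).
Proof. by rewrite (orientP D e) !inE orbC. Qed.

Lemma sedge_tail_head e : sedge (tail D e) (Defs.head D e).
Proof.
case/imsetP: (valP e) => -[u v]; rewrite inE /= => uv Ee.
have /negPf uv_neq : u != v by apply: contraTneq uv => ->; rewrite sedge_irrefl.
have /setP E : [set u; v] = [set tail D e; Defs.head D e].
  exact: etrans (esym Ee) (orientP D e).
have := E (tail D e); have := E (Defs.head D e); have := E u; have := E v.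
rewrite !inE !eqxx orbT /= !orbT => Ev Eu /orP Eh /orP Et.
case: Eh Et Eu Ev => /eqP -> [] /eqP ->; rewrite ?eqxx ?uv_neq //=.
- by rewrite (eq_sym v) uv_neq.
- by rewrite sedge_sym.
Qed.

Lemma tail_neq_head e : tail D e != Defs.head D e.
Proof.
by apply: contraTneq (sedge_tail_head e) => ->; rewrite sedge_irrefl.
Qed.

(** The coefficient of [f z] in the vertex sum of [v], written as a sum over ends to match [inc]. *)
Definition touch z v : R :=
  match z with
  | inl w => (v == w)%:R
  | inr e => (v == Defs.head D e)%:R + (v == tail D e)%:R
  end.

Lemma touch_inr e v : touch (inr e) v = (incident e v)%:R.
Proof.
rewrite /incident mem_edge /=; have [->|_] := eqVneq v (Defs.head D e).
  by rewrite eq_sym (negPf (tail_neq_head e)) addr0.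
by rewrite add0r.
Qed.

(** For [z] the edge [e] itself the two terms cancel, which agrees with the entry 0. Another edge
    cannot meet both ends of [e], as it would have the same end set. *)
Lemma A_entryE e z :
  A_entry R D e z = touch z (Defs.head D e) - touch z (tail D e).
Proof.
have /negPf ht : Defs.head D e != tail D e by rewrite eq_sym tail_neq_head.
have /negPf th := tail_neq_head e.
rewrite /A_entry; case: z => [w|e']; rewrite ?touch_inr /=.
  rewrite !(eq_sym w); have [<-|_] := eqVneq (Defs.head D e) w.
    by rewrite th subr0.
  by rewrite sub0r; case: eqP; rewrite ?oppr0.
have [->|e'e] := eqVneq e' e.
  by rewrite /incident !mem_edge !eqxx orbT subrr.
case: (boolP (incident e' (Defs.head D e))) => [h_in|_] /=.
  case: (boolP (incident e' (tail D e))) => [t_in|_] /=; last by rewrite subr0.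
  case/eqP: e'e; apply: val_inj; rewrite (orientP D e).
  apply/setP => v; move: h_in t_in; rewrite /incident !mem_edge !inE.
  case/orP => /eqP Eh /orP[] /eqP Et; move: th ht; rewrite Eh Et ?eqxx //.
  by rewrite orbC.
by rewrite sub0r; case: incident; rewrite ?oppr0.
Qed.

End Orientation.

Section GridSymbols.
Variables (R : realType) (n m : nat) (D : orientation (grid n m)).

Definition coords (v : grid n m) : nat * nat :=
  let: (i, j) := v : 'I_n * 'I_m in (i : nat, j : nat).

Lemma coords_inj : injective coords.
Proof. by move=> [i j] [i' j'] [/val_inj -> /val_inj ->]. Qed.

(** The coordinate sum grows by 1 along a [grid_step], so comparing sums tells whether [D] directs
    [e] towards its smaller end. *)
Definition reversed (e : edge (grid n m)) : bool :=
  ((coords (Defs.head D e)).1 + (coords (Defs.head D e)).2 <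
   (coords (tail D e)).1 + (coords (tail D e)).2)%N.

Definition edge_sym (e : edge (grid n m)) :=
  if reversed e then (coords (Defs.head D e), coords (tail D e))
  else (coords (tail D e), coords (Defs.head D e)).

Definition velt_sym (z : velt (grid n m)) : vsym (nat * nat)%type :=
  match z with
  | inl v => inl (coords v)
  | inr e => inr (edge_sym e)
  end.

Lemma edge_sym_inj : injective edge_sym.
Proof.
move=> e e'; rewrite /edge_sym => E.
apply: val_inj; rewrite (orientP D e) (orientP D e').
by case: ifP E => _; case: ifP => _ [/coords_inj -> /coords_inj ->] //;
  rewrite setUC.
Qed.

Lemma velt_sym_inj : injective velt_sym.
Proof.
by move=> [v|e] [v'|e'] //= [] => [/coords_inj|/edge_sym_inj] ->.
Qed.

Lemma sedge_gridP (u v : grid n m) :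
  sedge u v = grid_step (coords u, coords v) || grid_step (coords v, coords u).
Proof.
case: u v => [i j] [i' j'].
rewrite /sedge /= /box_rel /= /path_rel /grid_step /= -!val_eqE /=; lia.
Qed.

Lemma edge_sym_rows e : edge_sym e \in grid_rows n m.
Proof.
have := sedge_tail_head D e; rewrite sedge_gridP /edge_sym /reversed.
case: (tail D e) (Defs.head D e) => [i j] [i' j'] /=; rewrite /grid_step /=.
move: (ltn_ord i) (ltn_ord j) (ltn_ord i') (ltn_ord j').
by case: ifP => /= ?; rewrite mem_grid_rows /grid_step /=; lia.
Qed.

Lemma coords_onto p : point_in n m p -> exists v, coords v = p.
Proof. by case: p => i j /andP[/= li lj]; exists (Ordinal li, Ordinal lj). Qed.

Lemma edge_sym_onto p : p \in grid_rows n m -> exists e, edge_sym e = p.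
Proof.
case: p => [[a b] [c d]]; rewrite mem_grid_rows => /and3P[st ltc ltd].
have [u Eu] : exists u, coords u = (a, b).
  by apply: coords_onto; move: st; rewrite /grid_step /point_in /=; lia.
have [v Ev] : exists v, coords v = (c, d).
  by apply: coords_onto; rewrite /point_in ltc.
have uv : sedge u v by rewrite sedge_gridP Eu Ev st.
have eP : [set u; v] \in edges (grid n m).
  by apply/imsetP; exists (u, v); rewrite ?inE.
pose e : edge (grid n m) := exist (fun e => e \in edges (grid n m)) _ eP.
exists e.
have mem_e w : (w == Defs.head D e) || (w == tail D e) = (w \in [set u; v]).
  exact: esym (mem_edge D e w).
have := mem_e (Defs.head D e); have := mem_e (tail D e).
rewrite !eqxx orbT !inE => /esym t_in /esym h_in.
have := edge_sym_rows e; have := tail_neq_head D e; rewrite /edge_sym.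
move: st; rewrite -Eu -Ev.
(* The two ends are [u] and [v] in some order; only the increasing order is listed in
   [grid_rows]. *)
have anti w w' : grid_step (coords w, coords w') ->
    (coords w', coords w) \in grid_rows n m = false.
  case: w w' => [i j] [i' j']; rewrite /= mem_grid_rows /grid_step /=; lia.
by case/orP: t_in => /eqP ->; case/orP: h_in => /eqP ->; rewrite ?eqxx //;
  case: ifP => // _ /anti ->.
Qed.
Lemma inc_velt_sym z v : inc R (velt_sym z) (coords v) = touch R D z v.
Proof.
case: z => [w|e] /=; first by rewrite (inj_eq coords_inj).
by rewrite /edge_sym; case: ifP => _ /=; rewrite !(inj_eq coords_inj) // addrC.
Qed.

(** [vpair] takes first end minus second, whereas [A_entry] takes head minus tail; the sign is thus
    -1 for the edges that are not reversed. *)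
Lemma A_entry_sym e z : A_entry R D e z =
  (if reversed e then 1 else -1) * vpair R (inr (edge_sym e)) (velt_sym z).
Proof.
rewrite A_entryE /= /edge_sym; case: (reversed e) => /=;
  rewrite !inc_velt_sym; ring.
Qed.

Lemma perm_edge_sym :
  perm_eq (map edge_sym (enum {: edge (grid n m)})) (grid_rows n m).
Proof.
apply: uniq_perm.
- by rewrite (map_inj_uniq edge_sym_inj) enum_uniq.
- exact: uniq_grid_rows.
move=> p; apply/mapP/idP => [[e _ ->]|/edge_sym_onto[e <-]].
  exact: edge_sym_rows.
by exists e; rewrite ?mem_enum.
Qed.

Lemma velt_sym_cols : exists zs, map velt_sym zs = grid_cols n m.
Proof.
suff H xs : {subset xs <= grid_cols n m} -> exists zs, map velt_sym zs = xs.
  exact: H.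
elim: xs => [|x xs IH] xs_in; first by exists [::].
have [|zs Ezs] := IH; first by move=> y yxs; rewrite xs_in ?inE ?yxs ?orbT.
have := mem_grid_cols (xs_in x (mem_head _ _)); case: x {xs_in} => [p|p].
  by case/coords_onto => v Ev; exists (inl v :: zs); rewrite /= Ezs Ev.
by case/edge_sym_onto => e Ee; exists (inr e :: zs); rewrite /= Ezs Ee.
Qed.

Lemma lper_A_entry : exists zs : seq (velt (grid n m)),
  [/\ uniq zs, size zs = #|{: edge (grid n m)}| &
      lper (A_entry R D) (enum {: edge (grid n m)}) zs != 0].
Proof.
have [zs Ezs] := velt_sym_cols; exists zs; split.
- by rewrite -(map_inj_uniq velt_sym_inj) Ezs uniq_grid_cols.
- rewrite -(size_map velt_sym) Ezs size_grid -(perm_size perm_edge_sym).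
  by rewrite size_map -cardE.
rewrite (lper_scale (in2W A_entry_sym)) mulf_neq0 //.
  rewrite prodf_seq_neq0; apply/allP => e _ /=.
  by case: reversed; rewrite ?oppr_eq0 oner_neq0.
rewrite -(lper_map (vpair R) (fun e => inr (edge_sym e)) velt_sym) Ezs.
rewrite (map_comp inr) (lper_perm_rows _ _ (perm_map _ perm_edge_sym)).
exact: lper_grid.
Qed.
End GridSymbols.

Lemma lper_enum (R : comNzRingType) n (B : 'I_n -> 'I_n -> R) :
  lper B (enum 'I_n) (enum 'I_n) = per (\matrix_(i, j) B i j).
Proof.
rewrite /per; under eq_bigr do under eq_bigr do rewrite mxE.
(* [lperE] needs default indices, so the empty matrix is treated apart. *)
case: n B => [|n] B; last first.
  rewrite (lperE ord0 ord0 B (n := n.+1)) ?size_enum_ord //.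
  by apply: eq_bigr => s _; apply: eq_bigr => i _; rewrite !nth_ord_enum.
have -> : enum 'I_0 = [::] by apply/size0nil; rewrite size_enum_ord.
rewrite (eq_bigr (fun=> 1)) => [|s _]; last exact: big_ord0.
by rewrite sumr_const (eq_card (B := 'S_0)) ?card_Sn.
Qed.

Lemma per_selectable_lper (R : realType) (G : sgraph) (D : orientation G) zs :
    uniq zs -> size zs = #|{: edge G}| ->
    lper (A_entry R D) (enum {: edge G}) zs != 0 ->
  per_selectable (A_mx R D) 1.
Proof.
move=> zs_uniq /eqP szs; pose t := Tuple szs => per_neq0.
pose c := [ffun i => enum_rank (tnth t i)].
apply/existsP; exists c; apply/andP; split.
  move: per_neq0; rewrite -[zs]/(tval t) -map_tnth_enum.
  have -> : enum {: edge G} = map enum_val (enum 'I_#|{: edge G}|).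
    rewrite -[LHS](map_tnth_enum (enum_tuple {: edge G})).
    by apply: eq_map => i; rewrite (tnth_nth (enum_val i)) -enum_val_nth.
  rewrite lper_map lper_enum; congr (per _ != 0).
  by apply/matrixP => i j; rewrite !mxE ffunE enum_rankK.
apply/forallP => j; rewrite leqNgt; apply/card_gt1P => -[i [k [+ + /eqP[]]]].
rewrite !inE !ffunE => /eqP <- /eqP/enum_rank_inj.
by move/(tuple_uniqP t zs_uniq) => ->.
Qed.

Lemma pind_eq1 (R : comNzRingType) m n (A : 'M[R]_(m, n)) :
  per_selectable A 1 -> pind A = Some 1%N.
Proof.
move=> A1; rewrite /pind; case: pselect => [ex_k|[]]; last by exists 1%N.
case: ex_minnP => k /andP[k_gt0 _] /(_ 1%N A1) k_le1.
by congr Some; lia.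
Qed.

Lemma per_selectable_grid (R : realType) n m (D : orientation (grid n m)) :
  per_selectable (A_mx R D) 1.
Proof.
by have [zs [zs_uniq szs]] := lper_A_entry R D; apply: per_selectable_lper.
Qed.

(** * Choosability from a nonzero permanent *)

(** A form of Ryser's formula in which the constants [g e] drop out. Expanding the products, a
    choice [F] of one term per factor survives the alternating sum only if it uses every index [i];
    with [N] factors it is then a permutation. *)
Lemma alternating_sum_prod (R : comNzRingType) N (g : 'I_N -> R)
    (h : 'I_N -> 'I_N -> R) :
  \sum_(T : {set 'I_N}) (-1) ^+ #|T| * \prod_e (g e + \sum_(i in T) h e i) =
  (-1) ^+ N * per (\matrix_(e, i) h e i).
Proof.
pose G e (o : unit + 'I_N) := if o is inr i then h e i else g e.
pose ok (T : {set 'I_N}) (o : unit + 'I_N) :=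
  if o is inr i then i \in T else true.
have GE (T : {set 'I_N}) e :
    g e + \sum_(i in T) h e i = \sum_o G e o * (ok T o)%:R.
  rewrite big_sumType /= (big_only1 tt) //= ?mulr1.
  congr (_ + _); rewrite big_mkcond; apply: eq_bigr => i _.
  by case: (i \in T); rewrite ?mulr1 ?mulr0.
pose hit (F : {ffun 'I_N -> unit + 'I_N}) i := [exists e, F e == inr i].
(* Only the sets [T] containing all indices hit by [F] count: an index in [T] contributes -1, and
   one outside contributes 1 if it is not hit and 0 otherwise. *)
have signE (F : {ffun 'I_N -> unit + 'I_N}) :
    \sum_(T : {set 'I_N}) (-1) ^+ #|T| * \prod_e (ok T (F e))%:R =
    \prod_i (-1 + (~~ hit F i)%:R) :> R.
  rewrite bigA_distr; apply: eq_bigr => T _.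
  rewrite -prodr_const big_mkcond.
  have -> : \prod_e (ok T (F e))%:R =
      \prod_i (if i \in T then 1 else (~~ hit F i)%:R) :> R.
    have [/forallP Fok|] := boolP [forall e, ok T (F e)].
      rewrite !big1 // => [i _|e _]; last by rewrite Fok.
      case: ifP => // iT; suff -> : hit F i = false by [].
      by apply/existsP => -[e /eqP Fe]; have := Fok e; rewrite Fe /= iT.
    rewrite negb_forall => /existsP[e Fe].
    rewrite (bigD1 e) //= (negPf Fe) mul0r.
    case Ee: (F e) Fe => [//|i] /= iT; rewrite (bigD1 i) //= (negPf iT).
    suff -> : hit F i by rewrite mul0r.
    by apply/existsP; exists e; rewrite Ee.
  rewrite -big_split; apply: eq_bigr => i _ /=.
  by case: ifP; rewrite ?mulr1 ?mul1r.
transitivity (\sum_(F : {ffun 'I_N -> unit + 'I_N})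
    \prod_e G e (F e) * \prod_i (-1 + (~~ hit F i)%:R)).
  under [RHS]eq_bigr do rewrite -signE big_distrr.
  rewrite exchange_big; apply: eq_bigr => T _.
  under eq_bigr do rewrite GE.
  rewrite bigA_distr_bigA big_distrr; apply: eq_bigr => F _ /=.
  by rewrite big_split mulrCA.
rewrite (bigID (fun F : {ffun 'I_N -> unit + 'I_N} => [forall i, hit F i])) /=.
rewrite [X in _ + X]big1 ?addr0; last first.
  move=> F; rewrite negb_forall => /existsP[i Fi].
  by rewrite [X in _ * X](bigD1 i) //= Fi addNr mul0r mulr0.
rewrite big_distrr /= (reindex (fun s : 'S_N => [ffun e => inr (s e)])) /=.
  apply: eq_big => [s|s _].
    apply/forallP => i; apply/existsP; exists (s^-1 i)%g.
    by rewrite ffunE permKV.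
  rewrite mulrC; congr (_ * _).
    rewrite -[N in RHS]card_ord -prodr_const; apply: eq_bigr => i _.
    suff -> : hit [ffun e => inr (s e)] i by rewrite addr0.
    by apply/existsP; exists (s^-1 i)%g; rewrite ffunE permKV.
  by apply: eq_bigr => e _; rewrite ffunE mxE.
(* The defaults, [e] in [p] and the identity in [inv], are never reached when [F] hits every index:
   by counting, [p F] is then a bijection. *)
pose p (F : {ffun 'I_N -> unit + 'I_N}) e := if F e is inr i then i else e.
pose inv F : 'S_N :=
  if injectiveP (p F) is ReflectT F_inj then perm F_inj else 1%g.
exists inv => [s _|F /forallP Fhit].
  have pE e : p [ffun e => inr (s e)] e = s e by rewrite /p ffunE.
  rewrite /inv; case: injectiveP => [q|[]].
    by apply/permP => e; rewrite permE.
  by move=> e e'; rewrite !pE; apply: perm_inj.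
have hitF i : exists e, F e == inr i by apply/existsP/Fhit.
pose r i := xchoose (hitF i).
have rE i : F (r i) = inr i by apply/eqP/(xchooseP (hitF i)).
have rK : cancel r (p F) by move=> i; rewrite /p rE.
have pK := canF_sym rK.
rewrite /inv; case: injectiveP => [q|[]]; last exact: can_inj pK.
by apply/ffunP => e; rewrite ffunE permE -[in RHS](pK e) rE.
Qed.

Lemma vertex_sum_touch (R : realType) (G : sgraph) (D : orientation G)
    (f : velt G -> R) v :
  vertex_sum f v = \sum_z touch R D z v * f z.
Proof.
rewrite big_sumType /vertex_sum; congr (_ + _).
  rewrite (big_only1 v) //= ?eqxx ?mul1r // => w /negPf wv _.
  by rewrite eq_sym wv mul0r.
rewrite [LHS]big_mkcond; apply: eq_bigr => e _; rewrite touch_inr.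
by case: (incident e v); rewrite ?mul1r ?mul0r.
Qed.

(** The product of these linear forms over all edges is nonzero exactly when the weighting is
    proper. *)
Lemma vertex_sum_diff (R : realType) (G : sgraph) (D : orientation G)
    (f : velt G -> R) (e : edge G) :
  vertex_sum f (Defs.head D e) - vertex_sum f (tail D e) =
  \sum_z A_entry R D e z * f z.
Proof.
rewrite !(vertex_sum_touch D) -sumrB; apply: eq_bigr => z _.
by rewrite A_entryE mulrBl.
Qed.

Lemma cardfs_gt1 (K : choiceType) (A : {fset K}) : (1 < #|` A|)%N ->
  exists p : K * K, [&& p.1 \in A, p.2 \in A & p.1 != p.2].
Proof.
move=> /[dup] A_gt1 /ltnW; rewrite cardfs_gt0 => /fset0Pn[x xA].
move: A_gt1; rewrite (cardfsD1 x) xA ltnS cardfs_gt0 => /fset0Pn[y].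
by rewrite !inE => /andP[yx yA]; exists (x, y); rewrite xA yA eq_sym.
Qed.

Lemma choosable_per_selectable (R : realType) (G : sgraph) (D : orientation G) :
  per_selectable (A_mx R D) 1 -> choosable R G 2 2.
Proof.
case/existsP => c /andP[per_neq0 /forallP c_le1] L Lv Le.
have c_inj : injective c.
  move=> i k cik; apply/eqP; apply: contraTT (c_le1 (c k)) => ik.
  by rewrite -ltnNge; apply/card_gt1P; exists i, k; rewrite !inE cik eqxx.
have /fin_all_exists[w wP] z :
    exists p : R * R, [&& p.1 \in L z, p.2 \in L z & p.1 != p.2].
  by apply: cardfs_gt1; case: z => [v|e]; rewrite ?Lv ?Le.
pose z i : velt G := enum_val (c i).
have z_inj : injective z by move=> i k /enum_val_inj/c_inj.
pose d i := (w (z i)).2 - (w (z i)).1.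
(* [f T] takes the second value on the selected [z i] with [i] in [T], and the first value
   everywhere else. *)
pose f (T : {set 'I_#|{: edge G}|}) y :=
  (w y).1 + \sum_(i in T) (y == z i)%:R * d i.
have fL T y : f T y \in L y.
  have /and3P[w1 w2 _] := wP y.
  have [/existsP[i /andP[iT /eqP yi]]|] := boolP [exists i in T, y == z i].
    rewrite /f (big_only1 i) // => [|k ki _].
      by rewrite yi eqxx mul1r addrC subrK -yi.
    by rewrite yi (inj_eq z_inj) eq_sym (negPf ki) mul0r.
  rewrite negb_exists => /forallP yT.
  rewrite /f big1 ?addr0 // => i iT; have := yT i.
  by rewrite iT /= => /negPf ->; rewrite mul0r.
apply: contrapT => no_f.
(* If no weighting from the lists is proper, every [f T] gives two adjacent vertices equal sums,
   which kills a factor. *)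
have prod0 T : \prod_(e : edge G)
    (vertex_sum (f T) (Defs.head D e) - vertex_sum (f T) (tail D e)) = 0.
  apply/eqP/negPn/negP => prod_neq0; apply: no_f; exists (f T) => // u v uv fuv.
  have eP : [set u; v] \in edges G by apply/imsetP; exists (u, v); rewrite ?inE.
  pose e : edge G := exist (fun e => e \in edges G) _ eP.
  case/negP: prod_neq0; rewrite (bigD1 e) //= mulf_eq0 subr_eq0.
  have mem_e x : (x == Defs.head D e) || (x == tail D e) = (x \in [set u; v]).
    exact: esym (mem_edge D e x).
  have := mem_e (Defs.head D e); have := mem_e (tail D e).
  rewrite !eqxx orbT !inE => /esym t_in /esym h_in.
  by case/orP: t_in => /eqP ->; case/orP: h_in => /eqP ->; rewrite ?fuv eqxx.
pose A (e k : 'I_#|{: edge G}|) := A_entry R D (enum_val e) (z k).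
have := alternating_sum_prod
  (fun e => \sum_y A_entry R D (enum_val e) y * (w y).1)
  (fun e i => A e i * d i).
rewrite big1 => [|T _]; last first.
  rewrite -[RHS](mulr0 ((-1) ^+ #|T|)) -[in RHS](prod0 T); congr (_ * _).
  rewrite [RHS](reindex _ (onW_bij _ (@enum_val_bij (edge G)))).
  apply: eq_bigr => e _; rewrite vertex_sum_diff.
  under [RHS]eq_bigr do rewrite mulrDr big_distrr.
  rewrite big_split [in RHS]exchange_big /=; congr (_ + _).
  apply: eq_bigr => i _.
  rewrite [RHS](big_only1 (z i)) //= ?eqxx ?mul1r // => y /negPf yz _.
  by rewrite yz mul0r mulr0.
move/esym/eqP; rewrite mulf_eq0 signr_eq0 /=; apply/negP.
(* The factor [d i] is common to column [i], and it is nonzero because the two chosen values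
   differ. *)
have -> : per (\matrix_(e, i) (A e i * d i)) =
    per (colsub c (A_mx R D)) * \prod_i d i.
  rewrite big_distrl; apply: eq_bigr => s _ /=.
  rewrite [\prod_i d i](reindex_inj (@perm_inj _ s)) -big_split.
  by apply: eq_bigr => i _; rewrite !mxE.
rewrite mulf_neq0 // prodf_seq_neq0; apply/allP => i _ /=.
by rewrite subr_eq0 eq_sym; case/and3P: (wP (z i)).
Qed.

Theorem corollary5 (R : realType) (n m : nat)
    (n_ge1 : (1 <= n)%N) (m_ge1 : (1 <= m)%N) :
  (forall D : orientation (grid n m), pind (A_mx R D) = Some 1%N) /\
  choosable R (grid n m) 2 2.
Proof.
split=> [D|]; first exact/pind_eq1/per_selectable_grid.
have [D] := orientation_exists (grid n m).
exact/choosable_per_selectable/(per_selectable_grid R D).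
Qed.
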